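(* For any treelike snark $G(T,C)$, we have $\chi'_N(G(T,C))\leq 6$.
   Context: A Halin graph is a plane graph obtained from a planar embedding of a tree $T$ with no degree-two vertices by joining its leaves by a cycle $C$ through the leaves in their clockwise order $l_1,\dots,l_n$. Let $K$ be a cubic Halin graph with $|V(K)|\geq 4$, with tree $T$ and cycle $C$. Let $P_0$ be the following 5-zone: it has vertices $x_1,\dots,x_8,y_1,y_2,y_3$ and edges $x_1x_2, x_1x_4, x_2x_3, x_2x_7, x_3x_5, x_4x_5, x_4x_6, x_5x_8, x_6x_7, x_7x_8, x_1y_1, y_1y_2, y_2y_3, x_8y_3$, together with five dangling semi-edges $b_1$ at $y_3$, $b_2$ at $y_1$, $b_3$ at $y_2$, $b_4$ at $x_3$, $b_5$ at $x_6$ (so $x_1,\dots,x_8$ induce the Petersen graph minus two adjacent vertices, and every vertex has degree $3$ counting semi-edges). The treelike snark $G(T,C)$ is obtained as follows: take $n$ copies $P_0^1,\dots,P_0^n$ of $P_0$; for each $i$, identify the vertex $y_2^i$ (the end of $b_3^i$) with the leaf $l_i$ of $T$, so that the edge of $T$ at $l_i$ plays the role of $b_3^i$; the edges of $C$ are not used; then for each $i$ (indices modulo $n$) join $b_4^i$ with $b_2^{i+1}$ into an edge and $b_5^i$ with $b_1^{i+1}$ into an edge. A $k$-edge-coloring is a proper edge-coloring with colors from $\{1,\dots,k\}$. For an edge-coloring $c$ and a vertex $v$, let $S_c(v)$ be the set of colors on edges incident with $v$. An edge $uv$ of a cubic graph is poor if $|S_c(u)\cup S_c(v)|=3$, rich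 if $|S_c(u)\cup S_c(v)|=5$, and normal if it is poor or rich. An edge-coloring is normal if every edge is normal. $\chi'_N(G)$ is the smallest $k$ such that $G$ admits a normal $k$-edge-coloring. *)

(* Defs.v *)
From HB Require Import structures.
From mathcomp Require Import all_boot perm.

Set Implicit Arguments.
Unset Strict Implicit.
Unset Printing Implicit Defensive.

(* A simple graph on a finite type V is a symmetric irreflexive relation. *)

Section Graphs.
Variables (V : finType) (G : rel V).

Definition nbr (v : V) : {set V} := [set u | G v u].

Definition deg (v : V) : nat := #|nbr v|.

Definition cubic : Prop := forall v, deg v = 3.

Definition leaf (v : V) : bool := deg v == 1.

Definition simple_graph : Prop := symmetric G /\ irreflexive G.

(* Two-element u-cycles [:: u; v] are edges traversed back and forth, not
   cycles of the graph. *)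
Definition acyclic : Prop := forall s : seq V, ucycle G s -> size s <= 2.

Definition is_tree : Prop :=
  [/\ simple_graph, (forall u v, connect G u v) & acyclic].

End Graphs.

(* Embeddings of a connected graph in the oriented plane are represented by
   combinatorial maps: rot v lists the neighbours of v in clockwise order, and
   Euler's formula singles out the maps of genus 0. *)

Section PlaneEmbedding.
Variables (V : finType) (G : rel V) (rot : V -> {perm V}).

(* rot v acts on the neighbours of v as a single cycle; its values elsewhere
   are irrelevant. *)
Definition rotation_system : Prop :=
  forall v u, G v u -> porbit (rot v) u = nbr G v.

Definition darts : {set V * V} := [set d | G d.1 d.2].

(* The successor of the dart u -> v on the boundary walk of the face to its
   left. Following the outer face in this way runs clockwise around the
   graph. *)
Definition face_step (d : V * V) : V * V := (d.2, rot d.2 d.1).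

Definition plane_embedding : Prop :=
  rotation_system /\ #|V| + fcard face_step darts = #|darts|./2 + 2.

End PlaneEmbedding.

Section Halin.
Variables (V : finType) (T : rel V) (rot : V -> {perm V}).
Variables (n : nat) (l : 'I_n -> V).

(* l enumerates the leaves in the order in which they occur on the boundary
   walk of the (only) face of the embedded tree T. *)
Definition clockwise_leaves : Prop :=
  [/\ injective l, codom l =i leaf T
    & exists2 d0, d0 \in darts T
      & codom l = [seq d.1 | d <- orbit (face_step rot) d0 & leaf T d.1]].

Definition leaf_cycle : rel V := fun u v =>
  [exists i, ((u == l i) && (v == l (ordS i)))
          || ((v == l i) && (u == l (ordS i)))].

Definition halin_graph : rel V := fun u v => T u v || leaf_cycle u v.

Definition is_halin : Prop :=
  [/\ is_tree T, (forall v, deg T v <> 2), plane_embedding T rot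
    & clockwise_leaves].

End Halin.

Inductive P0 : Type := x1 | x2 | x3 | x4 | x5 | x6 | x7 | x8 | y1 | y2 | y3.

Definition P0_list : seq P0 := [:: x1; x2; x3; x4; x5; x6; x7; x8; y1; y2; y3].

Definition P0_code (p : P0) : 'I_11 :=
  match p with
  | x1 => @Ordinal 11 0 isT | x2 => @Ordinal 11 1 isT
  | x3 => @Ordinal 11 2 isT | x4 => @Ordinal 11 3 isT
  | x5 => @Ordinal 11 4 isT | x6 => @Ordinal 11 5 isT
  | x7 => @Ordinal 11 6 isT | x8 => @Ordinal 11 7 isT
  | y1 => @Ordinal 11 8 isT | y2 => @Ordinal 11 9 isT
  | y3 => @Ordinal 11 10 isT
  end.

Definition P0_decode (i : 'I_11) : P0 := nth x1 P0_list i.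

Lemma P0_codeK : cancel P0_code P0_decode.
Proof. by case. Qed.

HB.instance Definition _ := Finite.copy P0 (can_type P0_codeK).

Definition P0_edges : seq (P0 * P0) :=
  [:: (x1, x2); (x1, x4); (x2, x3); (x2, x7); (x3, x5); (x4, x5); (x4, x6);
      (x5, x8); (x6, x7); (x7, x8); (x1, y1); (y1, y2); (y2, y3); (x8, y3)].

Definition P0_adj : rel P0 := fun p q =>
  ((p, q) \in P0_edges) || ((q, p) \in P0_edges).

(* A dangling semi-edge is represented by the vertex it is attached to. The
   semi-edge b3, at y2, is realised by the edge of T at the corresponding
   leaf. *)
Definition b1 : P0 := y3.
Definition b2 : P0 := y1.
Definition b4 : P0 := x3.
Definition b5 : P0 := x6.

Section TreelikeSnark.
Variables (V : finType) (T : rel V) (n : nat) (l : 'I_n -> V).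

(* Inner vertices of T, and the vertices of n copies of P0; the leaf l i is
   identified with, and so represented by, the vertex y2 of the i-th copy. *)
Definition snark_vertex : finType := ({v : V | ~~ leaf T v} + 'I_n * P0)%type.

Definition tree_vertex (a : snark_vertex) : option V :=
  match a with
  | inl v => Some (val v)
  | inr (i, y2) => Some (l i)
  | inr _ => None
  end.

Definition tree_adj : rel snark_vertex := fun a b =>
  match tree_vertex a, tree_vertex b with
  | Some u, Some v => T u v
  | _, _ => false
  end.

Definition copy_adj : rel snark_vertex := fun a b =>
  match a, b with
  | inr (i, p), inr (j, q) => (i == j) && P0_adj p q
  | _, _ => false
  end.

Definition link (a b : snark_vertex) : bool :=
  match a, b with
  | inr (i, p), inr (j, q) =>
      (j == ordS i) && (((p == b4) && (q == b2)) || ((p == b5) && (q == b1)))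
  | _, _ => false
  end.

Definition treelike_snark : rel snark_vertex := fun a b =>
  [|| tree_adj a b, copy_adj a b, link a b | link b a].

End TreelikeSnark.

Arguments treelike_snark {V} T {n} l.

(* An edge-coloring of G is given by c u v, the color of the edge uv; its
   values on non-adjacent pairs are irrelevant. *)

Section NormalColoring.
Variables (V : finType) (G : rel V) (k : nat) (c : V -> V -> 'I_k).

Definition edge_coloring : Prop :=
  (forall u v, G u v -> c u v = c v u) /\
  (forall v u w, G v u -> G v w -> u != w -> c v u != c v w).

Definition colors_at (v : V) : {set 'I_k} := [set c v u | u in nbr G v].

Definition poor (u v : V) : bool := #|colors_at u :|: colors_at v| == 3.

Definition rich (u v : V) : bool := #|colors_at u :|: colors_at v| == 5.

Definition normal_coloring : Prop :=
  edge_coloring /\ (forall u v, G u v -> poor u v || rich u v).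

End NormalColoring.

Definition normal_colorable (V : finType) (G : rel V) (k : nat) : Prop :=
  exists c : V -> V -> 'I_k, normal_coloring G c.

(* chi'_N(G) = k; stated as a relation because the minimum need not exist. *)
Definition normal_chromatic_index (V : finType) (G : rel V) (k : nat) : Prop :=
  normal_colorable G k /\ (forall j, normal_colorable G j -> k <= j).

(* Main.v *)
(** Color the tree properly with three colors, so that the three tree edges at
    an inner vertex always carry 0, 1 and 2. It then suffices to extend this to
    each copy of P0 in a way that does not depend on the rest of the graph: for
    every color [t] of the edge of the tree at the leaf there is a normal
    coloring of P0 in which all links [b4 b2] get 0 and all links [b5 b1] get 1,
    the vertices y1, y2 and y3 see exactly the colors 0, 1, 2, and the remaining
    colors at x3 and x6 are 3 and 5. Hence tree edges are poor and links are
    rich, whatever the colors [t] of the consecutive copies. *)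

From Stdlib Require Import Classical.
Require Import Defs.
From mathcomp Require Import all_boot perm.

Set Implicit Arguments.
Unset Strict Implicit.
Unset Printing Implicit Defensive.

(** Reduces the bound on the chromatic index to exhibiting one normal 6-edge-coloring. Excluded
    middle enters because [P] is an arbitrary proposition. *)
Lemma exists_least (P : nat -> Prop) (n : nat) :
  P n -> exists2 k, P k /\ (forall j, P j -> k <= j) & k <= n.
Proof.
elim/ltn_ind: n => n IHn Pn.
have [[j jn Pj]|noj] := classic (exists2 j, j < n & P j).
  by have [k kP kj] := IHn j jn Pj; exists k => //; apply: leq_trans kj (ltnW jn).
exists n; rewrite //; split=> // j Pj; rewrite leqNgt; apply/negP => jn.
by apply: noj; exists j.
Qed.

(** * Proper edge colorings of trees *)

Section TreeColoring.
Variables (V : finType) (T : rel V).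
Hypothesis treeT : is_tree T.

Let T_sym : symmetric T. Proof. by case: treeT => -[]. Qed.
Let T_irr : irreflexive T. Proof. by case: treeT => -[]. Qed.

Definition induced (S : {set V}) : rel V :=
  fun x y => [&& T x y, x \in S & y \in S].
Arguments induced S x y /.

(** Connectedness is part of the invariant: it makes an outside vertex attach to [S] by at most one
    edge. *)
Definition colorable_subtree (k : nat) (S : {set V}) : Prop :=
  {in S &, forall x y, connect (induced S) x y} /\
  exists f : V -> V -> 'I_k, edge_coloring (induced S) f.

(** Two distinct neighbours of [v] in [S], joined by a path inside [S], would close a cycle through
    [v]. *)
Lemma subtree_unique_nbr (S : {set V}) (u v w : V) :
  {in S &, forall x y, connect (induced S) x y} ->
  v \notin S -> u \in S -> w \in S -> T v u -> T v w -> w = u.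
Proof.
move=> conS vS uS wS Tvu Tvw; have /connectP[p0 p0P wE] := conS u w uS wS.
rewrite {}wE in wS Tvw *; case/shortenP: p0P wS Tvw => p pP p_uniq _ lS Tvl.
have pS : {subset p <= S}.
  move=> x; elim: p u pP {p_uniq Tvl lS uS Tvu} => //= y p IHp u.
  case/andP=> /and3P[_ _ yS] pP; rewrite inE => /predU1P[-> //|].
  exact: IHp pP.
have pT : path T u p by apply: sub_path pP => x y /andP[].
have cyc : ucycle T [:: v, u & p].
  rewrite /ucycle /= rcons_path pT Tvu T_sym Tvl /= -/(uniq (u :: p)) p_uniq.
  rewrite andbT inE negb_or; apply/andP; split.
    by apply: contraNneq vS => ->.
  by apply: contraNN vS => /pS.
(* The bound 2 on the size of closed walks forces [p] to be empty, so its endpoint is [u]. *)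
case: treeT => _ _ /(_ _ cyc); by case: (p).
Qed.

(** The vertex [v] hangs from [S] by the single edge [uv], so any color still free at [u] serves for
    it. *)
Lemma colorable_subtree_step (k : nat) (S : {set V}) (u v : V) :
  u \in S -> v \notin S -> T u v -> deg T u <= k ->
  colorable_subtree k S -> colorable_subtree k (v |: S).
Proof.
move=> uS vS Tuv deg_u [conS [f [f_sym f_proper]]].
have only_u w : w \in S -> T v w -> w = u.
  by move=> wS; apply: (subtree_unique_nbr conS vS uS wS); rewrite T_sym.
have indS x y : induced S x y -> induced (v |: S) x y.
  by case/and3P=> Txy xS yS; rewrite /= Txy !inE xS yS !orbT.
have ind_sym : symmetric (induced (v |: S)).
  by move=> x y /=; rewrite T_sym [(x \in _) && _]andbC.
have con_u x : x \in v |: S -> connect (induced (v |: S)) u x.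
  case/setU1P=> [->|xS]; first by rewrite connect1 //= Tuv !inE eqxx uS orbT.
  by apply: connect_sub (conS u x uS xS) => y z /indS; apply: connect1.
split.
  move=> x y xS yS; apply: connect_trans (con_u y yS).
  by rewrite (sym_connect_sym ind_sym) con_u.
(* A free color exists because [v] is a neighbour of [u] outside [S], so fewer than [deg T u] colors
   are taken. *)
have [c0 c0P] : exists c0, c0 \notin [set f u w | w in nbr T u :&: S].
  apply/existsP; rewrite -negb_forall; apply/negP => /forallP full.
  have imk : #|[set f u w | w in nbr T u :&: S]| = k.
    by rewrite -[RHS]card_ord; apply: eq_card => x; rewrite [RHS]inE [LHS]full.
  suff: k < k by rewrite ltnn.
  rewrite -[X in X < _]imk.
  apply: leq_ltn_trans (leq_imset_card _ _) _; apply: leq_trans _ deg_u.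
  apply: proper_card; apply/properP; split; first exact: subsetIl.
  by exists v; rewrite !inE ?Tuv // (negPf vS).
exists (fun x y => if (x == v) || (y == v) then c0 else f x y); split.
  move=> x y /and3P[Txy xS yS]; rewrite orbC; case: ifP => // /norP[yv xv].
  apply: f_sym; rewrite /= Txy.
  by move: xS yS; rewrite !inE (negPf xv) (negPf yv) /= => -> ->.
have new_edge y : y \in S -> T u y -> c0 != f u y.
  move=> yS Tuy; apply: contraNneq c0P => ->.
  by apply/imsetP; exists y; rewrite // !inE yS Tuy.
move=> x a b /and3P[Txa xS aS] /and3P[Txb _ bS] ab.
have xa : x != a by apply: contraTneq Txa => ->; rewrite T_irr.
have xb : x != b by apply: contraTneq Txb => ->; rewrite T_irr.
have [xv|xv] /= := eqVneq x v.
  rewrite {x xS}xv in Txa Txb xa xb *.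
  have {}aS : a \in S by move: aS; rewrite !inE eq_sym (negPf xa).
  have {}bS : b \in S by move: bS; rewrite !inE eq_sym (negPf xb).
  by rewrite (only_u a aS Txa) (only_u b bS Txb) eqxx in ab.
have {}xS : x \in S by move: xS; rewrite !inE (negPf xv).
have [av|av] := eqVneq a v; have [bv|bv] := eqVneq b v.
- by rewrite av bv eqxx in ab.
- have {}bS : b \in S by move: bS; rewrite !inE (negPf bv).
  have xu : x = u by apply: only_u; rewrite // T_sym -av.
  by rewrite xu in Txb *; apply: new_edge.
- have {}aS : a \in S by move: aS; rewrite !inE (negPf av).
  have xu : x = u by apply: only_u; rewrite // T_sym -bv.
  by rewrite xu in Txa *; rewrite eq_sym; apply: new_edge.
move: aS bS; rewrite !inE (negPf av) (negPf bv) /= => aS bS.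
by apply: f_proper; rewrite //= ?Txa ?Txb xS.
Qed.

(** A colored subtree grows from one vertex, a vertex at a time, until it covers [V]. *)
Lemma tree_edge_colorable (k : nat) :
  0 < k -> (forall v, deg T v <= k) ->
  exists f : V -> V -> 'I_k, edge_coloring T f.
Proof.
move=> k_gt0 degT.
have [x0 _|V0] := pickP (predT : pred V); last first.
  by exists (fun _ _ => Ordinal k_gt0); split=> u; have := V0 u.
suff: forall m, m < #|V| -> exists2 S : {set V}, #|S| = m.+1 & colorable_subtree k S.
  have V_gt0 : 0 < #|V| by apply/card_gt0P; exists x0.
  case/(_ #|V|.-1); rewrite ?prednK // => S cardS [_ [f [f_sym f_proper]]].
  have inS x : x \in S.
    suff -> : S = [set: V] by rewrite inE.
    by apply/eqP; rewrite eqEcard subsetT cardsT cardS leqnn.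
  exists f; split=> [u v Tuv|v u w Tvu Tvw]; first by apply: f_sym; rewrite /= Tuv !inS.
  by apply: f_proper; rewrite /= ?Tvu ?Tvw !inS.
elim=> [_|m IHm mV].
  exists [set x0]; rewrite ?cards1 //; split.
    by move=> x y /set1P-> /set1P->; apply: connect0.
  exists (fun _ _ => Ordinal k_gt0); split=> // v u w /and3P[Tvu].
  by move=> /set1P vE /set1P uE; rewrite vE uE T_irr in Tvu.
have [S cardS colS] := IHm (ltnW mV).
have [/existsP[u /andP[uS /existsP[v /andP[vS Tuv]]]]|noedge] :=
    boolP [exists u in S, exists v, (v \notin S) && T u v].
  exists (v |: S); first by rewrite cardsU1 vS cardS.
  exact: colorable_subtree_step Tuv (degT u) colS.
(* If no edge leaves [S], connectedness of the tree makes [S] all of [V], against its size. *)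
have closedS : closed T (mem S).
  apply: intro_closed => [x y|x y Txy xS]; first by rewrite (sym_connect_sym T_sym).
  apply: contraR noedge => yS; apply/existsP; exists x; rewrite [x \in S]xS.
  by apply/existsP; exists y; rewrite yS.
have [x xS] : exists x, x \in S by apply/card_gt0P; rewrite cardS.
suff SV : S = [set: V] by move: mV; rewrite -cardsT -SV cardS ltnn.
apply/setP=> y; rewrite [RHS]inE; case: treeT => _ conT _.
by have /= <- := closed_connect closedS (conT x y).
Qed.

End TreeColoring.

(** * Colorings of a single copy of [P0], checked by computation *)

Definition color (m : nat) : 'I_6 := Ordinal (@ltn_pmod m 6 isT).

(* The colors of [P0_edges], in this order, when b3 has color t. The rows 0 and
   1 are obtained from row 2 by Kempe switches along the paths b3, y2y3, y3x8,
   x8x7 (colors 0 and 2) and b3, y2y1, y1x1, x1x2 (colors 1 and 2). *)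
Definition P0_row (t : nat) : seq nat :=
  match t with
  | 0 => [:: 1; 0; 3; 4; 5; 4; 3; 1; 5; 2; 2; 1; 2; 0]
  | 1 => [:: 2; 0; 3; 4; 5; 4; 3; 1; 5; 0; 1; 2; 0; 2]
  | _ => [:: 1; 0; 3; 4; 5; 4; 3; 1; 5; 0; 2; 1; 0; 2]
  end.

(** [P0_edges] holds one orientation of each edge. Non-edges get index 14, past the end of every
    row, so symmetry needs no adjacency hypothesis. *)
Definition P0_edge_index (p q : P0) : nat :=
  index (if (p, q) \in P0_edges then (p, q) else (q, p)) P0_edges.

Definition P0_color (t : nat) (p q : P0) : 'I_6 :=
  color (nth 0 (P0_row t) (P0_edge_index p q)).

Definition link_color (p q : P0) : 'I_6 :=
  if (p == b4) || (q == b4) then color 0 else color 1.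

Definition P0_nbrs (p : P0) : seq P0 := [seq q <- P0_list | P0_adj p q].

Definition outer_colors (t : nat) (p : P0) : seq 'I_6 :=
  match p with
  | y1 | x3 => [:: color 0]
  | y3 | x6 => [:: color 1]
  | y2 => [:: color t]
  | _ => [::]
  end.

Definition palette (t : nat) (p : P0) : seq 'I_6 :=
  [seq P0_color t p q | q <- P0_nbrs p] ++ outer_colors t p.

Definition normal_pair (s1 s2 : seq 'I_6) : bool :=
  size (undup (s1 ++ s2)) \in [:: 3; 5].

Definition tree_palette : seq 'I_6 := [:: color 0; color 1; color 2].

Lemma palette_uniq (t : 'I_3) (p : P0) : uniq (palette t p).
Proof. by case: t => -[|[|[|]]] // ?; case: p; vm_compute. Qed.

Lemma palette_y2 (t : 'I_3) : palette t y2 =i tree_palette.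
Proof. by apply: perm_mem; case: t => -[|[|[|]]] // ?; vm_compute. Qed.

Lemma P0_color_sym (t : nat) (p q : P0) : P0_color t p q = P0_color t q p.
Proof.
suff : P0_edge_index p q = P0_edge_index q p by rewrite /P0_color => ->.
by case: p; case: q; vm_compute.
Qed.

Lemma P0_normal (t : 'I_3) (p q : P0) :
  P0_adj p q -> normal_pair (palette t p) (palette t q).
Proof. by case: t => -[|[|[|]]] // ?; case: p; case: q; vm_compute. Qed.

(** The palettes are {0,3,5} or {1,3,5} against {0,1,2}, five colors in all. Consecutive copies may
    have different tree colors, hence both [t] and [t']. *)
Lemma link_normal (t t' : 'I_3) :
  normal_pair (palette t b4) (palette t' b2) &&
  normal_pair (palette t b5) (palette t' b1).
Proof. by case: t => -[|[|[|]]] // ?; case: t' => -[|[|[|]]] // ?; vm_compute. Qed.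

(** * Properness and normality read off lists of colors *)

Section LocalCriteria.
Variables (V : finType) (G : rel V) (c : V -> V -> 'I_6).

Lemma proper_at (v : V) (s : seq V) :
  nbr G v =i s -> uniq (map (c v) s) ->
  forall u w, G v u -> G v w -> u != w -> c v u != c v w.
Proof.
move=> nbr_s s_uniq u w Gvu Gvw; apply: contraNneq => cuw.
have us : u \in s by rewrite -nbr_s inE.
have ws : w \in s by rewrite -nbr_s inE.
rewrite -(nth_index u us) -(nth_index u ws); apply/eqP; congr nth.
apply/eqP; rewrite -(nth_uniq (c v u) _ _ s_uniq) ?size_map ?index_mem //.
by rewrite !(nth_map u) ?index_mem // !nth_index // cuw.
Qed.

Lemma colors_at_map (v : V) (s : seq V) :
  nbr G v =i s -> colors_at G c v =i map (c v) s.
Proof.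
move=> nbr_s x; apply/imsetP/mapP => -[u us ->]; exists u => //.
  by rewrite -nbr_s.
by rewrite nbr_s.
Qed.

Lemma normal_pairP (u v : V) (s1 s2 : seq 'I_6) :
  colors_at G c u =i s1 -> colors_at G c v =i s2 -> normal_pair s1 s2 ->
  poor G c u v || rich G c u v.
Proof.
move=> us vs; rewrite /normal_pair /poor /rich.
suff -> : #|colors_at G c u :|: colors_at G c v| = size (undup (s1 ++ s2)).
  by rewrite !inE.
rewrite -(card_uniqP (undup_uniq _)); apply: eq_card => x.
by rewrite mem_undup mem_cat inE us vs.
Qed.

End LocalCriteria.

(** * The coloring of the whole snark *)

Section SnarkColoring.
Variables (V : finType) (T : rel V) (n : nat) (l : 'I_n -> V).
Hypotheses (l_inj : injective l) (l_leaf : codom l =i leaf T).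
Hypothesis (deg_inner : forall v, ~~ leaf T v -> deg T v = 3).
Variable f : V -> V -> 'I_3.
Hypothesis f_coloring : edge_coloring T f.

Local Notation snark := (treelike_snark T l).
Local Notation vertex := (snark_vertex T n).
Local Notation at_copy i p := (inr (i, p) : vertex).

(** A leaf has exactly one tree edge, so the pick is forced and [ord0] never occurs. *)
Definition leaf_color (i : 'I_n) : 'I_3 :=
  if [pick u | T (l i) u] is Some u then f (l i) u else ord0.

(** Testing [P0_adj] besides [i == j] keeps links apart from copy edges even if [ordS i = i]. *)
Definition copy_color (a b : vertex) : 'I_6 :=
  match a, b with
  | inr (i, p), inr (j, q) =>
      if (i == j) && P0_adj p q then P0_color (leaf_color i) p q
      else link_color p q
  | _, _ => color 0
  end.

Definition snark_color (a b : vertex) : 'I_6 :=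
  match tree_vertex l a, tree_vertex l b with
  | Some u, Some v => color (f u v)
  | _, _ => copy_color a b
  end.

Lemma l_is_leaf (i : 'I_n) : leaf T (l i).
Proof. by have := l_leaf (l i); rewrite codom_f. Qed.

Lemma tree_vertex_onto (u : V) : exists a : vertex, tree_vertex l a = Some u.
Proof.
have [u_leaf|u_inner] := boolP (leaf T u); last first.
  by exists (inl (exist _ u u_inner)).
have /codomP[i ->] : u \in codom l by rewrite l_leaf.
by exists (at_copy i y2).
Qed.

Lemma tree_vertex_inj (a b : vertex) (u : V) :
  tree_vertex l a = Some u -> tree_vertex l b = Some u -> a = b.
Proof.
case: a b => [a|[i []]] [b|[j []]] //= [<-] [].
- by move/val_inj->.
- by move=> E; have /negP[] := valP a; rewrite /= -E l_is_leaf.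
- by move=> E; have /negP[] := valP b; rewrite /= E l_is_leaf.
- by move/l_inj->.
Qed.

(** Within a copy only [y2] is a tree vertex; it carries no link and is not adjacent to itself. *)
Lemma tree_adjE (a b : vertex) (u v : V) :
  tree_vertex l a = Some u -> tree_vertex l b = Some v -> snark a b = T u v.
Proof.
move=> Ea Eb; rewrite /treelike_snark /tree_adj Ea Eb.
have -> : copy_adj a b = false.
  by move: Ea Eb; case: a b => [a|[i []]] // [b|[j []]] //= _ _; rewrite andbF.
have nolink (a' b' : vertex) u' v' :
    tree_vertex l a' = Some u' -> tree_vertex l b' = Some v' -> link a' b' = false.
  by case: a' b' => [a'|[i []]] // [b'|[j []]] //= _ _; rewrite andbF.
by rewrite (nolink _ _ _ _ Ea Eb) (nolink _ _ _ _ Eb Ea) !orbF.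
Qed.

Lemma snark_color_sym (a b : vertex) :
  snark a b -> snark_color a b = snark_color b a.
Proof.
case: f_coloring => f_sym _; rewrite /snark_color.
have other : copy_color a b = copy_color b a.
  case: a b => [a|[i p]] [b|[j q]] //=.
  rewrite /P0_adj orbC eq_sym P0_color_sym /link_color [(p == _) || _]orbC.
  by case: eqP => //= ->.
case Ea: (tree_vertex l a) => [u|]; case Eb: (tree_vertex l b) => [v|] //.
by rewrite (tree_adjE Ea Eb) => Tuv; rewrite f_sym.
Qed.

Lemma inner_nbr (w : {v | ~~ leaf T v}) (b : vertex) :
  snark (inl w) b -> exists2 u, tree_vertex l b = Some u & T (val w) u.
Proof.
move=> Gwb; case Eb: (tree_vertex l b) => [u|].
  by exists u; rewrite // -(@tree_adjE (inl w) b _ _ erefl Eb).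
by move: Gwb; rewrite /treelike_snark /tree_adj /= Eb; case: (b) => [?|[? ?]].
Qed.

Lemma inner_proper (w : {v | ~~ leaf T v}) (a b : vertex) :
  snark (inl w) a -> snark (inl w) b -> a != b ->
  snark_color (inl w) a != snark_color (inl w) b.
Proof.
case: f_coloring => _ f_proper.
move=> /inner_nbr[u Ea Tu] /inner_nbr[v Eb Tv] ab.
have uv : u != v.
  by apply: contraNneq ab => E; rewrite E in Ea; rewrite (tree_vertex_inj Ea Eb).
have := f_proper _ _ _ Tu Tv uv; rewrite /snark_color /= Ea Eb; apply: contraNN.
move=> /eqP/(congr1 val) /=.
by rewrite !modn_small ?(leq_trans (ltn_ord _)) // => /val_inj->.
Qed.

Lemma inner_colors (w : {v | ~~ leaf T v}) :
  colors_at snark snark_color (inl w) =i tree_palette.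
Proof.
case: f_coloring => _ f_proper x.
(* Three edges with distinct colors among three use every color. *)
have all3 : [set f (val w) u | u in nbr T (val w)] = [set: 'I_3].
  apply/eqP; rewrite eqEcard subsetT cardsT card_ord card_in_imset.
    by rewrite [#|_|](deg_inner (valP w)).
  move=> u v; rewrite !inE => Tu Tv; apply: contra_eq => uv.
  exact: f_proper.
have -> : (x \in tree_palette) = [exists t : 'I_3, x == color t].
  apply/idP/existsP.
    rewrite !inE => /or3P[] xE; [by exists (@Ordinal 3 0 isT)|
      by exists (@Ordinal 3 1 isT)| by exists (@Ordinal 3 2 isT)].
  by case=> -[[|[|[|]]]] // ? /eqP->; vm_compute.
apply/imsetP/existsP.
  case=> a; rewrite inE => /inner_nbr[u Ea Tu] ->; exists (f (val w) u).
  by rewrite /snark_color /= Ea.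
case=> t /eqP->; have /imsetP[u Tu ->] : t \in [set f (val w) u | u in nbr T (val w)].
  by rewrite all3.
have [a Ea] := tree_vertex_onto u; rewrite inE in Tu.
by exists a; rewrite ?inE /treelike_snark /tree_adj /snark_color /= Ea ?Tu.
Qed.

Definition is_outer (a b : vertex) : bool :=
  [|| tree_adj l a b, link a b | link b a].

Definition link_ends (i : 'I_n) (p : P0) : seq vertex :=
  match p with
  | x3 => [:: at_copy (ordS i) y1]
  | x6 => [:: at_copy (ordS i) y3]
  | y1 => [:: at_copy (ord_pred i) x3]
  | y3 => [:: at_copy (ord_pred i) x6]
  | _ => [::]
  end.

Lemma at_copy_eq (i j : 'I_n) (p q : P0) :
  (at_copy i p == at_copy j q) = (i == j) && (p == q).
Proof. by []. Qed.

Lemma link_endsE (i : 'I_n) (p : P0) (b : vertex) :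
  link (at_copy i p) b || link b (at_copy i p) = (b \in link_ends i p).
Proof.
have ordS_eq (j : 'I_n) : (i == ordS j) = (j == ord_pred i).
  by apply/eqP/eqP => ->; rewrite ?ordSK ?ord_predK.
case: b => [b|[j q]]; first by case: p.
rewrite /= ordS_eq.
by case: p; rewrite /= ?inE ?at_copy_eq ?andbF ?orbF //; case: q; rewrite ?andbF ?orbF.
Qed.

(** For [y2] the single outer neighbour is that of the leaf in the tree; elsewhere only links leave
    the copy. *)
Lemma outer_star (i : 'I_n) (p : P0) :
  exists2 s : seq vertex, is_outer (at_copy i p) =i s &
    map (snark_color (at_copy i p)) s = outer_colors (leaf_color i) p.
Proof.
have [->|py2] := eqVneq p y2; last first.
  exists (link_ends i p).
    by move=> b; rewrite -link_endsE; case: p py2.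
  case: p py2 => //= _; congr [:: _]; rewrite /snark_color /= ?andbF //.
have [u Tu] : exists u, nbr T (l i) = [set u] by apply/cards1P/l_is_leaf.
have Tlu v : T (l i) v = (v == u) by rewrite -in_set1 -Tu inE.
have [a Ea] := tree_vertex_onto u; exists [:: a].
  move=> b; rewrite inE -[LHS]/(is_outer _ b) /is_outer link_endsE orbF /tree_adj /=.
  case Eb: (tree_vertex l b) => [v|]; last first.
    by apply/esym/eqP => E; rewrite E Ea in Eb.
  rewrite Tlu; apply/eqP/eqP => [E|E]; last by apply: Some_inj; rewrite -Ea -Eb E.
  by rewrite E in Eb; apply: tree_vertex_inj Eb Ea.
rewrite /= /snark_color /= Ea /leaf_color; case: pickP => [v|/(_ u)]; rewrite Tlu ?eqxx //.
by move=> /eqP->.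
Qed.

Lemma copy_adjE (i : 'I_n) (p : P0) (b : vertex) :
  copy_adj (at_copy i p) b = (b \in [seq at_copy i q | q <- P0_nbrs p]).
Proof.
have all_P0 q : q \in P0_list by case: q.
apply/idP/mapP => [|[q]]; last first.
  by rewrite mem_filter => /andP[Apq _] ->; rewrite /= eqxx.
case: b => [//|[j q]] /= /andP[/eqP <- Apq].
by exists q; rewrite // mem_filter Apq all_P0.
Qed.

(** Carries the computed facts about [palette] over to the snark. *)
Lemma copy_star (i : 'I_n) (p : P0) :
  exists2 s : seq vertex, nbr snark (at_copy i p) =i s &
    map (snark_color (at_copy i p)) s = palette (leaf_color i) p.
Proof.
have [s sE s_col] := outer_star i p.
exists ([seq at_copy i q | q <- P0_nbrs p] ++ s).
  by move=> b; rewrite inE mem_cat -sE -copy_adjE -[b \in _]/(is_outer _ b) orbCA.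
rewrite map_cat s_col -map_comp; congr cat; apply/eq_in_map => q.
rewrite mem_filter => /andP[Apq _]; rewrite /= /snark_color.
have E : copy_color (at_copy i p) (at_copy i q) = P0_color (leaf_color i) p q.
  by rewrite /= eqxx Apq.
(* The tree case of [snark_color] would need [p] and [q] both to be [y2], which [Apq] excludes. *)
by rewrite E /=; case: p q Apq {sE s_col E} => -[].
Qed.

Lemma copy_colors (i : 'I_n) (p : P0) :
  colors_at snark snark_color (at_copy i p) =i palette (leaf_color i) p.
Proof. by have [s sE <-] := copy_star i p; apply: colors_at_map. Qed.

Lemma tree_vertex_colors (a : vertex) (u : V) :
  tree_vertex l a = Some u -> colors_at snark snark_color a =i tree_palette.
Proof.
case: a => [w|[i []]] // _; first exact: inner_colors.
by move=> x; rewrite copy_colors palette_y2.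
Qed.

Lemma link_edge_normal (a b : vertex) :
  link a b -> poor snark snark_color a b || rich snark snark_color a b.
Proof.
case: a b => [//|[i p]] [//|[j q]] /=.
have /andP[n42 n51] := link_normal (leaf_color i) (leaf_color j).
case/andP=> _ /orP[] /andP[/eqP-> /eqP->].
  exact: normal_pairP (copy_colors i b4) (copy_colors j b2) n42.
exact: normal_pairP (copy_colors i b5) (copy_colors j b1) n51.
Qed.

Lemma snark_color_normal : normal_coloring snark snark_color.
Proof.
split; first split; first exact: snark_color_sym.
  move=> [w|[i p]] a b; first exact: inner_proper.
  have [s sE s_col] := copy_star i p; apply: (proper_at sE).
  by rewrite s_col palette_uniq.
move=> a b /or4P[Tab|Cab|Lab|Lba].
- move: Tab; rewrite /tree_adj; case Ea: (tree_vertex l a) => [u|] //.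
  case Eb: (tree_vertex l b) => [v|] // _.
  (* Both ends see exactly 0, 1, 2, so the edge is poor. *)
  exact: normal_pairP (tree_vertex_colors Ea) (tree_vertex_colors Eb) _.
- case: a b Cab => [//|[i p]] [//|[j q]] /= /andP[/eqP <- Apq].
  exact: normal_pairP (copy_colors i p) (copy_colors i q) (P0_normal _ Apq).
- exact: link_edge_normal.
by rewrite /poor /rich setUC; apply: link_edge_normal.
Qed.

End SnarkColoring.

Theorem theorem6 (V : finType) (T : rel V) (rot : V -> {perm V})
    (n : nat) (l : 'I_n -> V) :
  is_halin T rot l ->
  cubic (halin_graph T l) ->
  4 <= #|V| ->
  exists2 k : nat,
    normal_chromatic_index (treelike_snark T l) k & k <= 6.
Proof.
case=> treeT _ _ [l_inj l_leaf _] cubicK _; apply: exists_least.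
have deg_inner v : ~~ leaf T v -> deg T v = 3.
  move=> v_inner; rewrite -(cubicK v); apply: eq_card => u; rewrite !inE /halin_graph.
  (* The cycle meets only leaves, so an inner vertex keeps in [T] its degree 3 from the cubic Halin
     graph. *)
  suff -> : leaf_cycle l v u = false by rewrite orbF.
  have not_l i : v == l i = false.
    by apply: contraNF v_inner => /eqP->; have := l_leaf (l i); rewrite codom_f.
  by apply/existsP => -[i]; rewrite !not_l andbF.
have [|f f_coloring] := @tree_edge_colorable V T treeT 3 isT.
  move=> v; have [/eqP-> //|/deg_inner-> //] := boolP (leaf T v).
by exists (snark_color (T := T) l f); apply: snark_color_normal.
Qed.
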